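(* Let $\mathcal{H}$ be a complex separable Hilbert space, let $\Phi=(\phi_n)_{n=1}^\infty$ and $\Psi=(\psi_n)_{n=1}^\infty$ be frames for $\mathcal{H}$, and let the complex sequence $m=(m_n)_{n=1}^\infty$ satisfy $0<\inf_n|m_n|\le\sup_n|m_n|<\infty$. Assume that the multiplier $M_{m,\Phi,\Psi}$ is invertible. Then: \begin{itemize} \item there exists a unique dual frame $\Phi^\dagger$ of $\Phi$ such that for every dual frame $\Psi^d$ of $\Psi$ we have $$M_{m,\Phi,\Psi}^{-1}=M_{1/m,\Psi^d,\Phi^\dagger};$$ \item there exists a unique dual frame $\Psi^\dagger$ of $\Psi$ such that for every dual frame $\Phi^d$ of $\Phi$ we have $$M_{m,\Phi,\Psi}^{-1}=M_{1/m,\Psi^\dagger,\Phi^d}.$$ \end{itemize}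
   Context: A sequence $\Phi=(\phi_n)_{n=1}^\infty$ in $\mathcal{H}$ is a frame for $\mathcal{H}$ if there are $0<A\le B<\infty$ with $A\|h\|^2\le\sum_n|\langle h,\phi_n\rangle|^2\le B\|h\|^2$ for all $h\in\mathcal{H}$. A dual frame of a frame $\Phi$ is a frame $\Phi^d=(\phi^d_n)$ for $\mathcal{H}$ with $h=\sum_n\langle h,\phi^d_n\rangle\phi_n$ for all $h\in\mathcal{H}$. For a complex sequence $m$ and sequences $\Phi,\Psi$ in $\mathcal{H}$, the multiplier is the operator $M_{m,\Phi,\Psi}h=\sum_{n=1}^\infty m_n\langle h,\psi_n\rangle\phi_n$ (inner product linear in the first argument); it is a well-defined bounded operator on $\mathcal{H}$ when $m\in\ell^\infty$ and $\Phi,\Psi$ are frames. The symbol $1/m$ denotes the sequence $(1/m_n)$. An operator $\mathcal{H}\to\mathcal{H}$ is invertible if it is a bounded bijection of $\mathcal{H}$ onto $\mathcal{H}$. *)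

(* Defs.v *)
From HB Require Import structures.
From mathcomp Require Import all_boot all_order all_algebra.
From mathcomp Require Import complex.
From mathcomp Require Import all_classical all_reals all_analysis.
Set Implicit Arguments.
Unset Strict Implicit.
Unset Printing Implicit Defensive.
Import Order.TTheory GRing.Theory Num.Theory Num.Def.
Import numFieldNormedType.Exports.
Local Open Scope classical_set_scope.
Local Open Scope complex_scope.
Local Open Scope ring_scope.

(* In a normed space over R[i] the norm takes (real, nonnegative) values in
   R[i]; rnorm is the same number seen in R. It applies to vectors as well as
   to scalars, where it is the modulus. *)
Definition rnorm (R : realType) (V : normedZmodType R[i]) (x : V) : R :=
  complex.Re `|x|.

Definition separable (T : topologicalType) :=
  exists2 D : set T, countable D & dense D.

Section Hilbert.
Variables (R : realType) (H : completeNormedModType R[i]).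

(* A form of type {dot H for conjC} is linear in its first argument and
   conjugate-linear in its second one. *)
Definition hilbert_inner (dot : {dot H for @conjC R[i]}) :=
  forall x : H, dot x x = `|x| ^+ 2.

Variable dot : {dot H for @conjC R[i]}.
Implicit Types (F G : nat -> H) (m : nat -> R[i]) (T : H -> H).

(* The sum of squares is taken in \bar R, where it is always defined. *)
Definition is_frame F :=
  exists A B : R, [/\ 0 < A, A <= B & forall h : H,
    ((A * rnorm h ^+ 2)%:E <=
       \sum_(0 <= n <oo) (rnorm (dot h (F n)) ^+ 2)%:E <=
     (B * rnorm h ^+ 2)%:E)%E].

Definition is_dual_frame F Fd :=
  [/\ is_frame F, is_frame Fd &
      forall h : H, series (fun n => dot h (Fd n) *: F n) @ \oo --> h].

Definition multiplier m F G : H -> H :=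
  fun h => limn (series (fun n => (m n * dot h (G n)) *: F n)).

Definition inv_seq m : nat -> R[i] := fun n => (m n)^-1.

Definition seminormalized m :=
  (0 < ereal_inf (range (fun n => (rnorm (m n))%:E)))%E /\
  (ereal_sup (range (fun n => (rnorm (m n))%:E)) < +oo)%E.

Definition bounded_operator T :=
  linear T /\ exists C : R, forall h, rnorm (T h) <= C * rnorm h.

Definition invertible_operator T := bounded_operator T /\ bijective T.

(* The inverse of T when T is bijective, a default value otherwise. *)
Definition inverse_operator T : H -> H := pinv [set: H] T.

End Hilbert.

(* Main.v *)
(** Write [T] for the inverse of [M = M_(m, Phi, Psi)]. From [T (M h) = h] and
    [M (T h) = h] one reads off [h = \sum_n <h, psi_n> m_n T phi_n] and
    [h = \sum_n m_n <T h, psi_n> phi_n], so [Psi^dag] is [m_n T phi_n] and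
    [Phi^dag] consists of the vectors representing [h |-> m_n <T h, psi_n>].
    These vectors exist because a reconstruction formula
    [h = \sum_n <h, g_n> f_n] turns a bounded functional [f] into the inner
    product with [\sum_n conj (f f_n) g_n]. That both sequences are Bessel needs
    [T] bounded. As the adjoint of [M] is a multiplier too, this needs neither
    Baire's theorem nor orthogonal projections: a gliding hump shows that [M^*]
    is bounded below, and [M M^* x = y] is then solved by a contraction.
    For uniqueness, if [Fd] is a dual frame of [F], then so is
    [Fd n + (delta_(n, j) - <Fd n, F j>) e] for all [j] and [e]; comparing the
    identities for these dual frames isolates the [j]-th vector. *)

Require Import Defs.
From HB Require Import structures.
From mathcomp Require Import all_boot all_order all_algebra.
From mathcomp Require Import complex ring lra.
From mathcomp Require Import all_classical all_reals all_analysis.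
Set Implicit Arguments.
Unset Strict Implicit.
Unset Printing Implicit Defensive.
Import Order.TTheory GRing.Theory Num.Theory Num.Def.
Import numFieldNormedType.Exports.
Local Open Scope classical_set_scope.
Local Open Scope complex_scope.
Local Open Scope ring_scope.

(** * The real-valued norm and geometric convergence *)

Section RealNorm.
Variable R : realType.
Local Notation C := R[i].

Section Zmod.
Variable V : normedZmodType C.
Implicit Types x y : V.

Lemma rnormE x : `|x| = (rnorm x)%:C.
Proof. by have /complex_realP[r e] := normr_real x; rewrite /rnorm e. Qed.

Lemma rnorm_ge0 x : 0 <= rnorm x.
Proof. by rewrite -(@lecR R) -rnormE normr_ge0. Qed.

Lemma rnorm0 : rnorm (0 : V) = 0.
Proof. by rewrite /rnorm normr0. Qed.

Lemma rnorm0_eq0 x : rnorm x = 0 -> x = 0.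
Proof. by move=> h; apply: normr0_eq0; rewrite rnormE h. Qed.

Lemma ler_rnormD x y : rnorm (x + y) <= rnorm x + rnorm y.
Proof. by rewrite -(@lecR R) rmorphD /= -!rnormE ler_normD. Qed.

Lemma rnormN x : rnorm (- x) = rnorm x.
Proof. by rewrite /rnorm normrN. Qed.

Lemma rdistrC x y : rnorm (x - y) = rnorm (y - x).
Proof. by rewrite /rnorm distrC. Qed.

Lemma ler_rdistD x y z : rnorm (x - z) <= rnorm (x - y) + rnorm (y - z).
Proof. by rewrite -(subrKA y) ler_rnormD. Qed.

End Zmod.

Lemma rnormM (a b : C) : rnorm (a * b) = rnorm a * rnorm b.
Proof. by apply: (@complexI R); rewrite rmorphM /= -!rnormE normrM. Qed.

Lemma rnorm_conj (a : C) : rnorm (conjC a) = rnorm a.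
Proof. by rewrite /rnorm norm_conjC. Qed.

Lemma rnormV (a : C) : rnorm a^-1 = (rnorm a)^-1.
Proof. by apply: (@complexI R); rewrite fmorphV /= -!rnormE normfV. Qed.

Lemma rnorm_real (r : R) : rnorm r%:C = `|r|.
Proof. by apply: (@complexI R); rewrite -rnormE normc_def /= expr0n addr0 sqrtr_sqr. Qed.

Lemma conjC_realc (r : R) : conjC r%:C = r%:C.
Proof. by apply/CrealP/complex_realP; exists r. Qed.

Lemma rnormCK (a : C) : a * conjC a = (rnorm a ^+ 2)%:C.
Proof. by rewrite -normCK rnormE rmorphXn. Qed.

Lemma rnormZ (V : normedModType C) (a : C) (x : V) :
  rnorm (a *: x) = rnorm a * rnorm x.
Proof. by apply: (@complexI R); rewrite rmorphM /= -!rnormE normrZ. Qed.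

(** Turns filter convergence, whose tolerances are positive elements of [R[i]], into real epsilons;
    a positive element of [R[i]] is real. *)
Lemma rnorm_cvgP (V : normedModType C) (u : nat -> V) (x : V) :
  u @ \oo --> x <->
  forall e : R, 0 < e -> exists N, forall n, (N <= n)%N -> rnorm (x - u n) < e.
Proof.
split=> [/cvgrPdist_lt h e e0|h].
  have [|N _ hN] := h e%:C; first by rewrite ltcR.
  by exists N => n /hN /=; rewrite rnormE ltcR.
apply/cvgrPdist_lt => e e0.
have /complex_realP[r er] : e \is Num.real by exact: gtr0_real.
have [|N hN] := h r; first by rewrite -(@ltcR R) -er.
by exists N => // n /hN; rewrite /= rnormE er ltcR.
Qed.

Lemma rnorm_cauchy_cvg (V : completeNormedModType C) (u : nat -> V) :
  (forall e : R, 0 < e -> exists N, forall n k, (N <= n)%N -> (n <= k)%N ->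
    rnorm (u k - u n) < e) -> cvgn u.
Proof.
move=> h; apply/cauchy_cvgP/cauchy_exP => e e0.
have /complex_realP[r er] : e \is Num.real by exact: gtr0_real.
have [|N hN] := h r; first by rewrite -(@ltcR R) -er.
exists (u N); exists N => // n /= Nn; rewrite -ball_normE /=.
by rewrite rnormE rdistrC er ltcR hN.
Qed.

Lemma geometric_small (K q e : R) : 0 <= q < 1 -> 0 < e ->
  exists n, K * q ^+ n < e.
Proof.
move=> /andP[q0 q1] e0; have : (fun n => K * q ^+ n) @ \oo --> K * 0.
  by apply: cvgMr; apply: cvg_expr; rewrite ger0_norm.
rewrite mulr0 => /cvgrPdist_lt/(_ _ e0)[n _ /(_ n (leqnn n))] /=.
by rewrite sub0r normrN => /(le_lt_trans (ler_norm _)); exists n.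
Qed.

(** The increments telescope into a geometric sum. The explicit rate serves both the gliding hump
    and the fixed-point iteration. *)
Lemma cvgn_geometric (V : completeNormedModType C) (u : nat -> V) (K q : R) :
  0 <= q < 1 -> (forall n, rnorm (u n.+1 - u n) <= K * q ^+ n) ->
  exists l, u @ \oo --> l /\ forall n, rnorm (l - u n) <= K / (1 - q) * q ^+ n.
Proof.
move=> /andP[q0 q1] hu; have q1' : 0 < 1 - q by rewrite subr_gt0.
have K0 : 0 <= K by rewrite -[K]mulr1 -(expr0 q) (le_trans _ (hu 0%N)) ?rnorm_ge0.
have bnd n k : (n <= k)%N -> rnorm (u k - u n) <= K / (1 - q) * q ^+ n.
  move=> /subnKC <-; move: (k - n)%N => {}k.
  suff : rnorm (u (n + k)%N - u n) <= K / (1 - q) * (q ^+ n - q ^+ (n + k)).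
    move=> /le_trans; apply; apply: ler_wpM2l; first by rewrite divr_ge0// ltW.
    by rewrite gerBl exprn_ge0.
  elim: k => [|k IH]; first by rewrite addn0 !subrr rnorm0 mulr0.
  rewrite addnS; apply: (le_trans (ler_rdistD _ (u (n + k)%N) _)).
  apply: (le_trans (lerD (hu _) IH)); rewrite exprS le_eqVlt; apply/orP; left.
  by apply/eqP; field; rewrite subr_eq0 eq_sym lt_eqF.
have /cvg_ex[l ul] : cvgn u.
  apply: rnorm_cauchy_cvg => e e0; have [||N hN] := @geometric_small (K / (1 - q)) q (e / 2).
  - by rewrite q0.
  - by rewrite divr_gt0.
  exists N => n k Nn nk; rewrite (splitr e); apply: le_lt_trans (ler_rdistD _ (u N) _) _.
  rewrite (rdistrC (u N)); apply: ltrD; apply: le_lt_trans (bnd _ _ _) hN => //.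
  exact: leq_trans nk.
exists l; split=> // n; apply/ler_addgt0Pr => e e0.
have /rnorm_cvgP/(_ _ e0)[N hN] := ul.
rewrite [leRHS]addrC; apply: le_trans (ler_rdistD _ (u (maxn N n)) _) (lerD _ _).
  by apply/ltW/hN; rewrite leq_maxl.
by apply: bnd; rewrite leq_maxr.
Qed.

End RealNorm.

(** * Cauchy-Schwarz and limits of inner products *)

Section InnerProduct.
Variables (R : realType) (H : completeNormedModType R[i]).
Variable dot : {dot H for @conjC R[i]}.
Hypothesis hdot : hilbert_inner dot.
Implicit Types (x y z : H) (u v : nat -> H).

Lemma dotC x y : dot x y = conjC (dot y x).
Proof. by rewrite hermC expr0 mul1r. Qed.

Lemma dotZl a x y : dot (a *: x) y = a * dot x y.
Proof. exact: linearZl_LR. Qed.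

Lemma dotZr a x y : dot x (a *: y) = conjC a * dot x y.
Proof. exact: linearZr_LR. Qed.

Lemma dotxx x : dot x x = (rnorm x ^+ 2)%:C.
Proof. by rewrite hdot rnormE rmorphXn. Qed.

Lemma rnorm_dotC x y : rnorm (dot x y) = rnorm (dot y x).
Proof. by rewrite dotC rnorm_conj. Qed.

Lemma cauchy_schwarz x y : rnorm (dot x y) <= rnorm x * rnorm y.
Proof.
have [->|y0] := eqVneq y 0.
  by rewrite linear0r !rnorm0 mulr0.
have s0 : 0 < rnorm y.
  by rewrite lt_def rnorm_ge0 andbT; apply: contraNneq y0 => /rnorm0_eq0 ->.
pose s := rnorm y; pose a := dot x y.
(* The residual of [x] after projection on [y], scaled by [|y|^2] so that no division occurs. *)
have : 0 <= dot ((s ^+ 2)%:C *: x - a *: y) ((s ^+ 2)%:C *: x - a *: y).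
  by rewrite dotxx lecR sqr_ge0.
rewrite dnormB !dnormZ !dotxx dotZl dotZr -/a.
have -> : (s ^+ 2)%:C * (conjC a * a) = (s ^+ 2 * rnorm a ^+ 2)%:C.
  by rewrite mulrC (mulrC (conjC a)) rnormCK -rmorphM mulrC.
rewrite conjC_realc !rnormE rnorm_real ger0_norm ?sqr_ge0//.
rewrite -!rmorphXn -!rmorphM -!rmorphD -rmorphB lecR -/s => h.
rewrite -(@ler_pXn2r _ 2) ?nnegrE ?mulr_ge0 ?rnorm_ge0// exprMn -/a -/s.
have {}h : 0 <= s ^+ 2 * (rnorm x ^+ 2 * s ^+ 2 - rnorm a ^+ 2) by lra.
by move: h; rewrite pmulr_rge0 ?subr_ge0// exprn_gt0.
Qed.

Lemma dot_ext x y : (forall z, dot x z = dot y z) -> x = y.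
Proof.
move=> h; apply/eqP; rewrite -subr_eq0; apply/eqP/rnorm0_eq0.
have : dot (x - y) (x - y) = 0 by rewrite linearBl/= h subrr.
by rewrite dotxx => -[] /eqP; rewrite sqrf_eq0 => /eqP.
Qed.

(** Both maps are Lipschitz, so equality along the sequences passes to the limits. They are additive
    only, so that the conjugate-linear [dot w] is covered. *)
Lemma additive_cvg_eq (f g : H -> R[i]) (K L : R) u v x z :
  (forall x y, f (x - y) = f x - f y) -> (forall x, rnorm (f x) <= K * rnorm x) ->
  (forall x y, g (x - y) = g x - g y) -> (forall x, rnorm (g x) <= L * rnorm x) ->
  u @ \oo --> x -> v @ \oo --> z -> (forall n, f (u n) = g (v n)) -> f x = g z.
Proof.
move=> fB bf gB bg /rnorm_cvgP ux /rnorm_cvgP vz e.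
apply/eqP; rewrite -subr_eq0; apply/eqP/rnorm0_eq0/eqP.
rewrite eq_le rnorm_ge0 andbT; apply/ler_addgt0Pr => eps eps0; rewrite add0r.
pose M := `|K| + `|L| + 1.
have M0 : 0 < M by rewrite ltr_wpDl// addr_ge0.
have e0 : 0 < eps / M by rewrite divr_gt0.
have [p hp] := ux _ e0; have [q hq] := vz _ e0.
have := hp _ (leq_maxl p q); have := hq _ (leq_maxr p q).
set n := maxn p q => b a.
have -> : f x - g z = f (x - u n) - g (z - v n).
  by rewrite fB gB e opprB addrA subrK.
apply: le_trans (ler_rnormD _ _) _; rewrite rnormN.
apply: (@le_trans _ _ (`|K| * (eps / M) + `|L| * (eps / M))).
  apply: lerD; [apply: (le_trans (bf _))|apply: (le_trans (bg _))].
    by rewrite (le_trans (ler_wpM2r (rnorm_ge0 _) (ler_norm _)))// ler_wpM2l// ltW.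
  by rewrite (le_trans (ler_wpM2r (rnorm_ge0 _) (ler_norm _)))// ler_wpM2l// ltW.
rewrite -mulrDl mulrCA -[leRHS]mulr1 ler_wpM2l//; first exact: ltW.
by rewrite ler_pdivrMr// mul1r /M lerDl.
Qed.

Lemma dot_cvg_eq u v x y z w : u @ \oo --> x -> v @ \oo --> z ->
  (forall n, dot (u n) y = dot w (v n)) -> dot x y = dot w z.
Proof.
apply: (@additive_cvg_eq (dot^~ y) (dot w) (rnorm y) (rnorm w)) => *.
- by rewrite linearBl.
- by rewrite mulrC cauchy_schwarz.
- by rewrite linearBr.
- exact: cauchy_schwarz.
Qed.

Lemma rnorm_cvg_le u x (K : R) : u @ \oo --> x -> (forall n, rnorm (u n) <= K) ->
  rnorm x <= K.
Proof.
move=> /rnorm_cvgP ux h; apply/ler_addgt0Pr => e /ux[N /(_ N (leqnn N)) hN].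
by rewrite -(subrK (u N) x) addrC (le_trans (ler_rnormD _ _))// lerD// ltW.
Qed.

Lemma cvg_unique_lim u x : u @ \oo --> x -> limn u = x.
Proof. by move=> ux; apply: cvg_lim => //; apply: norm_hausdorff. Qed.

Lemma bounded_linear_cvg (T : H -> H) (K : R) u x :
  (forall y z, T (y - z) = T y - T z) -> (forall y, rnorm (T y) <= K * rnorm y) ->
  u @ \oo --> x -> T \o u @ \oo --> T x.
Proof.
move=> TB bT /rnorm_cvgP ux; apply/rnorm_cvgP => e e0.
have K1 : 0 < `|K| + 1 by rewrite ltr_wpDl.
have [N hN] := ux (e / (`|K| + 1)) ltac:(by rewrite divr_gt0).
exists N => n /hN h /=; rewrite -TB; apply: (le_lt_trans (bT _)).
apply: (@le_lt_trans _ _ ((`|K| + 1) * rnorm (x - u n))).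
  by rewrite ler_wpM2r ?rnorm_ge0// (le_trans (ler_norm _))// lerDl.
by rewrite mulrC -ltr_pdivlMr.
Qed.

End InnerProduct.

(** * Bessel sequences and square-summable coefficients *)

Section Bessel.
Variables (R : realType) (H : completeNormedModType R[i]).
Variable dot : {dot H for @conjC R[i]}.
Hypothesis hdot : hilbert_inner dot.
Implicit Types (h x y : H) (F G : nat -> H) (c : nat -> R[i]) (B K : R).

Definition sqsum c (p q : nat) : R := \sum_(p <= n < q) rnorm (c n) ^+ 2.

Definition square_summable c := exists K, forall N, sqsum c 0 N <= K.

Definition bessel F B :=
  0 < B /\ forall h N, sqsum (fun n => dot h (F n)) 0 N <= B * rnorm h ^+ 2.

Lemma sqsum_ge0 c p q : 0 <= sqsum c p q.
Proof. by apply: sumr_ge0 => n _; rewrite sqr_ge0. Qed.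

Lemma sqsum_cat c p q r : (p <= q)%N -> (q <= r)%N ->
  sqsum c p r = sqsum c p q + sqsum c q r.
Proof. exact: big_cat_nat. Qed.

Lemma sqsumM m c (C : R) p q : (forall n, rnorm (m n) <= C) ->
  sqsum (fun n => m n * c n) p q <= C ^+ 2 * sqsum c p q.
Proof.
move=> hm; rewrite /sqsum mulr_sumr; apply: ler_sum => n _.
rewrite rnormM exprMn ler_wpM2r ?sqr_ge0// lerXn2r// ?nnegrE ?rnorm_ge0//.
exact: le_trans (rnorm_ge0 _) (hm n).
Qed.

Lemma square_summableM m c (C : R) : (forall n, rnorm (m n) <= C) ->
  square_summable c -> square_summable (fun n => m n * c n).
Proof.
move=> hm [K hK]; exists (C ^+ 2 * K) => N.
by rewrite (le_trans (sqsumM _ _ _ hm))// ler_wpM2l ?sqr_ge0.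
Qed.

Lemma sqsumD c d p q :
  sqsum (fun n => c n + d n) p q <= 2 * (sqsum c p q + sqsum d p q).
Proof.
rewrite /sqsum -big_split mulr_sumr; apply: ler_sum => n _ /=.
have := ler_rnormD (c n) (d n); have := rnorm_ge0 (c n + d n).
move: (rnorm _) (rnorm (c n)) (rnorm (d n)) => a b e a0 h.
apply: (@le_trans _ _ ((b + e) ^+ 2)); first by rewrite lerXn2r ?nnegrE ?(le_trans a0).
by have := sqr_ge0 (b - e); lra.
Qed.

Lemma square_summableD c d : square_summable c -> square_summable d ->
  square_summable (fun n => c n + d n).
Proof.
move=> [K hK] [L hL]; exists (2 * (K + L)) => N.
by rewrite (le_trans (sqsumD _ _ _ _))// ler_wpM2l// lerD.
Qed.

Lemma square_summable_dot F B h : bessel F B ->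
  square_summable (fun n => dot h (F n)).
Proof. by move=> [_ hF]; exists (B * rnorm h ^+ 2) => N; apply: hF. Qed.

Lemma square_summable_tail c (e : R) : square_summable c -> 0 < e ->
  exists N, forall p q, (N <= p)%N -> (p <= q)%N -> sqsum c p q < e.
Proof.
move=> [K hK] e0.
pose S := [set sqsum c 0 N | N in setT].
have hS : has_sup S by split; [exists (sqsum c 0 0), 0%N|exists K => _ [N _ <-]].
have [_ [N _ <-] hN] := sup_adherent e0 hS.
exists N => p q Np pq.
have : sqsum c 0 q <= sup S by apply: sup_upper_bound => //; exists q.
rewrite (sqsum_cat c (leq0n p) pq) (sqsum_cat c (leq0n N) Np).
have := sqsum_ge0 c N p; lra.
Qed.

(** For the sum [v], [|v|^2 = \sum c n <F n, v>]. By AM-GM, [2 |v|^2] is at most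
    [B \sum |c n|^2 + B^-1 \sum |<v, F n>|^2]; the Bessel bound makes the last term at most [|v|^2],
    which is absorbed on the left. *)
Lemma bessel_synthesis F B c p q : bessel F B ->
  rnorm (\sum_(p <= n < q) c n *: F n) ^+ 2 <= B * sqsum c p q.
Proof.
move=> [B0 hF]; set v := \sum_(p <= n < q) _.
have hv : rnorm (dot v v) <= \sum_(p <= n < q) rnorm (c n) * rnorm (dot v (F n)).
  rewrite {1}/v linear_sumlz /=.
  elim/big_ind2: _ => [|a b a' b' ha hb|n _]; first by rewrite rnorm0.
    exact: le_trans (ler_rnormD _ _) (lerD ha hb).
  by rewrite dotZl rnormM (rnorm_dotC dot v).
have hFv : sqsum (fun n => dot v (F n)) p q <= B * rnorm v ^+ 2.
  have [pq|/ltnW qp] := leqP p q; last first.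
    by rewrite /sqsum big_geq// mulr_ge0 ?sqr_ge0 ?ltW.
  apply: le_trans (hF v q); rewrite (sqsum_cat _ (leq0n p) pq).
  by rewrite lerDr sqsum_ge0.
(* AM-GM with weight B: 2 a b <= B a^2 + b^2 / B *)
have amgm : 2 * \sum_(p <= n < q) rnorm (c n) * rnorm (dot v (F n)) <=
    B * sqsum c p q + B^-1 * sqsum (fun n => dot v (F n)) p q.
  rewrite /sqsum !mulr_sumr -big_split /=; apply: ler_sum => n _.
  set a := rnorm _; set b := rnorm _; rewrite -subr_ge0.
  have -> : B * a ^+ 2 + B^-1 * b ^+ 2 - 2 * (a * b) = B^-1 * (B * a - b) ^+ 2.
    by field; rewrite gt_eqF.
  by rewrite mulr_ge0 ?sqr_ge0// invr_ge0 ltW.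
move: hFv; rewrite -(ler_pM2l (_ : 0 < B^-1)) ?invr_gt0// mulKf ?gt_eqF// => hFv.
move: hv; rewrite dotxx// rnorm_real ger0_norm ?sqr_ge0// => hv.
lra.
Qed.

Lemma synthesis_cvg F B c : bessel F B -> square_summable c ->
  cvgn (series (fun n => c n *: F n)).
Proof.
move=> hF hc; apply: rnorm_cauchy_cvg => e e0; have B0 := hF.1.
have [|N hN] := @square_summable_tail c (e ^+ 2 / B) hc.
  by rewrite divr_gt0 ?exprn_gt0.
exists N => n k Nn nk; rewrite sub_series_geq//.
rewrite -(@ltr_pXn2r _ 2) ?nnegrE ?rnorm_ge0 ?ltW//.
apply: le_lt_trans (bessel_synthesis _ _ _ hF) _.
by rewrite mulrC -ltr_pdivlMr// hN.
Qed.

(* The duality behind this bound: for [v = \sum conj (f (F n)) F n] one has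
   [f v = \sum |f (F n)|^2], while [|v|^2 <= B \sum |f (F n)|^2]. *)
Lemma functional_sqsum F B (f : H -> R[i]) K p q : 0 <= B ->
  (forall c, rnorm (\sum_(p <= n < q) c n *: F n) ^+ 2 <= B * sqsum c p q) ->
  linear_for *%R f -> (forall h, rnorm (f h) <= K * rnorm h) ->
  sqsum (fun n => f (F n)) p q <= K ^+ 2 * B.
Proof.
move=> B0 hF lf bf; set s := sqsum _ p q.
pose f' : {scalar H} := HB.pack f (GRing.isLinear.Build _ _ _ _ _ lf).
pose v := \sum_(p <= n < q) conjC (f (F n)) *: F n.
have fv : f v = s%:C.
  transitivity (f' v); first by [].
  rewrite /v linear_sum rmorph_sum; apply: eq_bigr => n _.
  by rewrite linearZ_LR /= mulrC rnormCK.
have hv : rnorm v ^+ 2 <= B * s.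
  apply: le_trans (hF _) _; rewrite le_eqVlt; apply/orP; left; apply/eqP.
  by congr (_ * _); apply: eq_bigr => n _; rewrite rnorm_conj.
have s0 : 0 <= s by exact: sqsum_ge0.
have := bf v; rewrite fv rnorm_real ger0_norm// => sv.
have [->|sn0] := eqVneq s 0.
  by rewrite mulr_ge0 ?sqr_ge0.
have sp : 0 < s by rewrite lt_def sn0.
have : s ^+ 2 <= (K * rnorm v) ^+ 2 by rewrite lerXn2r ?nnegrE// (le_trans s0).
rewrite exprMn => h2; rewrite -(ler_pM2r sp) -expr2 (le_trans h2)//.
by rewrite -[leRHS]mulrA ler_wpM2l ?sqr_ge0.
Qed.

End Bessel.

(** * Frames, dual frames and their perturbations along a vector *)

Section Frames.
Variables (R : realType) (H : completeNormedModType R[i]).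
Variable dot : {dot H for @conjC R[i]}.
Hypothesis hdot : hilbert_inner dot.
Implicit Types (h x y : H) (F G : nat -> H) (c : nat -> R[i]) (B K : R).

Lemma frame_bessel F : is_frame dot F -> exists B, bessel dot F B.
Proof.
move=> [A [B [A0 AB hF]]]; exists B; split=> [|h N]; first exact: lt_le_trans AB.
have /andP[_] := hF h; rewrite -lee_fin; apply: le_trans.
rewrite /sqsum -sumEFin; apply: nneseries_lim_ge => n _ _.
by rewrite lee_fin sqr_ge0.
Qed.

(** Converse of [bessel_synthesis], by duality with the functional [x |-> <x, h>], which is bounded
    by [|h|]. *)
Lemma bessel_of_synthesis F B : 0 < B ->
  (forall c N, rnorm (\sum_(0 <= n < N) c n *: F n) ^+ 2 <= B * sqsum c 0 N) ->
  bessel dot F B.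
Proof.
move=> B0 hF; split=> // h N; rewrite mulrC.
have lf : linear_for *%R (fun x => dot x h) by move=> a x y; rewrite linearPl.
have bf x : rnorm (dot x h) <= rnorm h * rnorm x.
  by rewrite mulrC cauchy_schwarz.
apply: le_trans (functional_sqsum (ltW B0) (hF^~ N) lf bf).
by rewrite le_eqVlt; apply/orP; left; apply/eqP/eq_bigr => n _; rewrite rnorm_dotC.
Qed.

Lemma bessel_square_summable F B (f : H -> R[i]) K : bessel dot F B ->
  linear_for *%R f -> (forall h, rnorm (f h) <= K * rnorm h) ->
  square_summable (fun n => f (F n)).
Proof.
move=> hF lf bf; exists (K ^+ 2 * B) => N; apply: functional_sqsum lf bf.
  exact: ltW hF.1.
by move=> c; apply: bessel_synthesis.
Qed.

(** The lower bound comes from synthesis: [|h|^2 <= B \sum |<h, G n>|^2] by the Bessel bound of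
    [F]. *)
Lemma reconstruction_frame F G B B' : bessel dot F B -> bessel dot G B' ->
  (forall h, series (fun n => dot h (G n) *: F n) @ \oo --> h) ->
  is_frame dot G.
Proof.
move=> hF hG rec; have [B0 _] := hF; have [B'0 hG'] := hG.
(* The maximum keeps the two bounds in order even on the zero space. *)
exists B^-1, (Num.max B^-1 B'); split; first by rewrite invr_gt0.
  by rewrite le_max lexx.
move=> h; set g := fun n => (rnorm (dot h (G n)) ^+ 2)%:E.
have g0 n : (0 <= g n)%E by rewrite lee_fin sqr_ge0.
have gE N : (\sum_(0 <= n < N) g n)%E = (sqsum (fun n => dot h (G n)) 0 N)%:E.
  by rewrite /sqsum -sumEFin.
apply/andP; split; last first.
  apply: (lime_le (is_cvg_nneseries (fun n _ _ => g0 n))).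
  apply: nearW => N; rewrite gE lee_fin (le_trans (hG' _ _))//.
  by rewrite ler_wpM2r ?sqr_ge0// le_max lexx orbT.
have leg N : (\sum_(0 <= n < N) g n <= \sum_(0 <= n <oo) g n)%E.
  by apply: nneseries_lim_ge.
move: leg; case: (\sum_(0 <= n <oo) g n)%E => [l||] leg.
- have {}leg N : sqsum (fun n => dot h (G n)) 0 N <= l by rewrite -lee_fin -gE.
  have l0 : 0 <= l by apply: le_trans (leg 0%N); rewrite sqsum_ge0.
  rewrite lee_fin ler_pdivrMl//.
  have : rnorm h <= Num.sqrt (B * l).
    apply: (rnorm_cvg_le (rec h)) => N.
    rewrite -(@ler_pXn2r _ 2) ?nnegrE ?rnorm_ge0 ?sqrtr_ge0//.
    rewrite sqr_sqrtr ?mulr_ge0 ?(ltW B0)//.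
    apply: (le_trans (bessel_synthesis hdot (fun n => dot h (G n)) 0 N hF)).
    by rewrite ler_wpM2l// (ltW B0).
  rewrite -(@ler_pXn2r _ 2) ?nnegrE ?rnorm_ge0 ?sqrtr_ge0//.
  by rewrite sqr_sqrtr ?mulr_ge0 ?(ltW B0).
- by rewrite leey.
- by have := leg 0%N; rewrite big_geq.
Qed.

(** The swapped series converges by the Bessel bounds; moving its partial sums across the inner
    product with [y] shows that its sum [x] satisfies [<x, y> = <h, y>]. *)
Lemma reconstruction_swap F G B B' : bessel dot F B -> bessel dot G B' ->
  (forall h, series (fun n => dot h (G n) *: F n) @ \oo --> h) ->
  forall h, series (fun n => dot h (F n) *: G n) @ \oo --> h.
Proof.
move=> hF hG rec h.
have /cvg_ex[x hx] := synthesis_cvg hdot hG (square_summable_dot h hF).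
suff xh : x = h by move: hx; rewrite xh.
apply: (dot_ext hdot) => y.
apply: (dot_cvg_eq hdot hx (rec y)) => N.
rewrite /series /= linear_sumlz linear_sumr; apply: eq_bigr => n _ /=.
by rewrite dotZl dotZr mulrC -dotC.
Qed.

(** Reduces duality to two Bessel bounds and one reconstruction formula: the lower frame bounds come
    from the formula and its swap. *)
Lemma reconstruction_dual F G B B' : bessel dot F B -> bessel dot G B' ->
  (forall h, series (fun n => dot h (G n) *: F n) @ \oo --> h) ->
  is_dual_frame dot F G.
Proof.
move=> hF hG rec; split=> //; last exact: (reconstruction_frame hF hG rec).
exact: (reconstruction_frame hG hF (reconstruction_swap hF hG rec)).
Qed.

Lemma dual_frame_sym F G : is_dual_frame dot F G -> is_dual_frame dot G F.
Proof.
move=> [/frame_bessel[B hF] /frame_bessel[B' hG] rec].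
exact: (reconstruction_dual hG hF (reconstruction_swap hF hG rec)).
Qed.

Lemma riesz_dual_frame F G (f : H -> R[i]) K : is_dual_frame dot F G ->
  linear_for *%R f -> (forall h, rnorm (f h) <= K * rnorm h) ->
  exists x, forall h, f h = dot h x.
Proof.
move=> [/frame_bessel[B hF] /frame_bessel[B' hG] rec] lf bf.
have ss : square_summable (fun n => conjC (f (F n))).
  have [L hL] := bessel_square_summable hF lf bf; exists L => N.
  apply: le_trans (hL N); rewrite le_eqVlt; apply/orP; left; apply/eqP.
  by apply: eq_bigr => n _; rewrite rnorm_conj.
have /cvg_ex[x hx] := synthesis_cvg hdot hG ss.
exists x => h.
pose f' : {scalar H} := HB.pack f (GRing.isLinear.Build _ _ _ _ _ lf).
apply: (additive_cvg_eq (linearB f') bf _ _ (rec h) hx) => [y z|y|N].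
- by rewrite linearBr.
- exact: (cauchy_schwarz hdot).
- transitivity (f' (\sum_(0 <= n < N) dot h (G n) *: F n)); first by [].
  rewrite linear_sum /series /= linear_sumr; apply: eq_bigr => n _ /=.
  by rewrite dotZr conjCK -[LHS]/(f' _) linearZ_LR /= mulrC.
Qed.

Lemma besselD F G B B' : bessel dot F B -> bessel dot G B' ->
  bessel dot (fun n => F n + G n) (2 * (B + B')).
Proof.
move=> [B0 hF] [B'0 hG]; split=> [|h N]; first by rewrite mulr_gt0 ?addr_gt0.
have -> : (fun n => dot h (F n + G n)) = (fun n => dot h (F n) + dot h (G n)).
  by apply/funext => n; rewrite linearDr.
by rewrite (le_trans (sqsumD _ _ _ _))// -mulrA ler_wpM2l// mulrDl lerD.
Qed.

Lemma bessel_line a (e : H) : square_summable a ->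
  exists B, bessel dot (fun n => a n *: e) B.
Proof.
move=> [K hK]; exists (rnorm e ^+ 2 * K + 1); split=> [|h N].
  rewrite ltr_wpDl// mulr_ge0 ?sqr_ge0// (le_trans _ (hK 0%N))//.
  by rewrite /sqsum big_geq.
have -> : (fun n => dot h (a n *: e)) = (fun n => dot h e * conjC (a n)).
  by apply/funext => n; rewrite dotZr mulrC.
apply: le_trans (sqsumM _ _ _ (fun=> cauchy_schwarz hdot h e)) _.
have -> : sqsum (fun n => conjC (a n)) 0 N = sqsum a 0 N.
  by apply: eq_bigr => n _; rewrite rnorm_conj.
rewrite [leRHS](_ : _ = (rnorm h * rnorm e) ^+ 2 * K + rnorm h ^+ 2); last by ring.
by rewrite ler_wpDr ?sqr_ge0// ler_wpM2l ?sqr_ge0.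
Qed.

Lemma square_summable_delta (j : nat) :
  square_summable (fun n => (n == j)%:R : R[i]).
Proof.
exists 1 => N; apply: (@le_trans _ _ (j < N)%:R); last by case: (j < N)%N.
elim: N => [|N IH]; first by rewrite /sqsum big_geq.
rewrite /sqsum big_nat_recr//= ltnS leq_eqVlt; move: IH.
have [<-|Nj] := eqVneq j N; last by rewrite rnorm0 expr0n addr0.
by rewrite ltnn (rnorm_real 1) normr1 expr1n gerDr.
Qed.

(* Since [\sum_n c n <Fd n, F j> = <\sum_n c n Fd n, F j>], perturbing [Fd] along
   [e] changes only one coefficient of the sum, up to a term seen in the limit. *)
Lemma series_perturb_cvg F Fd c (j : nat) (e s : H) :
  series (fun n => c n *: Fd n) @ \oo --> s ->
  series (fun n => c n *: (Fd n + ((n == j)%:R - dot (Fd n) (F j)) *: e))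
    @ \oo --> s + (c j - dot s (F j)) *: e.
Proof.
move=> /rnorm_cvgP hs; pose S := series (fun n => c n *: Fd n).
(* Beyond [j] the Kronecker delta contributes exactly [c j], so only [S N] still varies. *)
have SE N : (j < N)%N ->
    series (fun n => c n *: (Fd n + ((n == j)%:R - dot (Fd n) (F j)) *: e)) N =
    S N + (c j - dot (S N) (F j)) *: e.
  move=> jN; rewrite /S /series /=.
  under eq_bigr do rewrite scalerDr scalerA.
  rewrite big_split /= -scaler_suml; congr (_ + _ *: _).
  rewrite linear_sumlz /=.
  under eq_bigr do rewrite mulrBr; rewrite sumrB; congr (_ - _).
    rewrite big_mkord (bigD1 (Ordinal jN)) //= eqxx mulr1 big1 ?addr0// => i.
    by rewrite -val_eqE /= => /negbTE ->; rewrite mulr0.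
  by apply: eq_bigr => n _; rewrite dotZl.
apply/rnorm_cvgP => eps eps0; pose M := 1 + rnorm (F j) * rnorm e.
have M0 : 0 < M by rewrite ltr_wpDr// mulr_ge0 ?rnorm_ge0.
have [N hN] := hs (eps / M) ltac:(by rewrite divr_gt0).
exists (maxn N j.+1) => n; rewrite geq_max => /andP[/hN + jn].
rewrite SE// -/S; set d := s - S n => hd.
have -> : s + (c j - dot s (F j)) *: e - (S n + (c j - dot (S n) (F j)) *: e) =
    d - dot d (F j) *: e.
  rewrite opprD addrACA -scalerBl -scaleNr /d linearBl /=; congr (_ + _ *: _).
  by ring.
apply: (@le_lt_trans _ _ (M * rnorm d)); last by rewrite mulrC -ltr_pdivlMr.
apply: le_trans (ler_rnormD _ _) _; rewrite rnormN rnormZ mulrDl mul1r lerD//.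
by rewrite mulrAC ler_wpM2r ?rnorm_ge0// mulrC cauchy_schwarz.
Qed.

(** With [c n = <h, F n>] the extra coefficient [c j - <h, F j>] in [series_perturb_cvg] vanishes,
    so [h] is still reconstructed. *)
Lemma dual_frame_perturb F Fd (j : nat) (e : H) : is_dual_frame dot F Fd ->
  is_dual_frame dot F
    (fun n => Fd n + ((n == j)%:R - dot (Fd n) (F j)) *: e).
Proof.
move=> dFd; pose a n := (n == j)%:R - dot (Fd n) (F j).
have [/frame_bessel[B hF] /frame_bessel[B' hFd] _] := dFd.
have [_ _ rec] := dual_frame_sym dFd.
have [K [L hL]] : exists B, bessel dot (fun n => a n *: e) B.
  apply: bessel_line; apply: square_summableD; first exact: square_summable_delta.
  exists (B' * rnorm (F j) ^+ 2) => N; apply: le_trans (hFd.2 (F j) N).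
  rewrite le_eqVlt; apply/orP; left; apply/eqP; apply: eq_bigr => n _.
  by rewrite rnormN rnorm_dotC.
apply: dual_frame_sym.
apply: (@reconstruction_dual (fun n => Fd n + a n *: e) _ _ _
  (besselD hFd (conj L hL)) hF) => h.
have := @series_perturb_cvg F Fd _ j e h (rec h).
by rewrite subrr scale0r addr0.
Qed.

End Frames.
Arguments series_perturb_cvg {R H dot} hdot F {Fd c} j e {s}.

(** * Bounded right inverse of a surjection that has an adjoint *)

Section BoundedInverse.
Variables (R : realType) (H : completeNormedModType R[i]).
Variable dot : {dot H for @conjC R[i]}.
Hypothesis hdot : hilbert_inner dot.
Implicit Types (x y z : H).

Variables A B : H -> H.
Hypothesis adj : forall x y, dot (A x) y = dot x (B y).

(** Linearity of both maps follows from the adjoint relation, since inner products separate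
    vectors. *)
Let BZ a x : B (a *: x) = a *: B x.
Proof.
apply: (dot_ext hdot) => z; apply: (can_inj (@conjCK _)).
by rewrite dotZl rmorphM /= -!dotC -!adj dotZr.
Qed.

Let BB x y : B (x - y) = B x - B y.
Proof.
apply: (dot_ext hdot) => z; apply: (can_inj (@conjCK _)).
by rewrite linearBl /= rmorphB /= -!dotC -!adj linearBr.
Qed.

Let AZ a x : A (a *: x) = a *: A x.
Proof. by apply: (dot_ext hdot) => z; rewrite adj !dotZl adj. Qed.

Let AB x y : A (x - y) = A x - A y.
Proof. by apply: (dot_ext hdot) => z; rewrite linearBl /= !adj linearBl. Qed.

(** [<y + t x, x>] and [<y - t x, x>] differ by [2 t], so one of them has modulus at least [t]. *)
Lemma dot_hump x y (t : R) : 0 <= t -> rnorm x = 1 ->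
  exists z, rnorm (z - y) <= t /\ t <= rnorm (dot z x).
Proof.
move=> t0 x1; set a := dot y x.
have dE s : dot (y + s%:C *: x) x = a + s%:C.
  by rewrite linearDl /= dotZl (dotxx hdot) x1 expr1n mulr1.
have zE s : rnorm (y + s%:C *: x - y) = `|s|.
  by rewrite addrAC subrr add0r rnormZ rnorm_real x1 mulr1.
have [h|h] := leP t (rnorm (a + t%:C)).
  by exists (y + t%:C *: x); rewrite zE dE ger0_norm.
exists (y + (- t)%:C *: x); rewrite zE dE normrN ger0_norm//; split=> //.
have := ler_rdistD (t%:C + a) 0 ((- t)%:C + a).
rewrite sub0r rnormN subr0 opprD addrACA subrr addr0 rmorphN opprK -rmorphD.
rewrite rnorm_real ger0_norm ?addr_ge0// (addrC t%:C) -rmorphN (addrC _ a).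
lra.
Qed.

(* Gliding hump: unit vectors [x n] with [B (x n)] of size [6^-n] would allow
   [l = \sum +-3^-n x n] with [|<l, x n>| >= 3^-n / 2], although
   [|<l, x n>| = |<z, B (x n)>| <= 6^-n |z|] when [l = A z]. *)
Lemma adjoint_bounded_below : (forall y, exists x, A x = y) ->
  exists2 c : R, 0 < c & forall x, c * rnorm x <= rnorm (B x).
Proof.
move=> surj; apply: contrapT => nob.
have small (c : R) : 0 < c -> exists x, rnorm x = 1 /\ rnorm (B x) <= c.
  move=> c0; apply: contrapT => /forallNP hc; apply: nob; exists c => // x.
  have [->|x0] := eqVneq x 0; first by rewrite rnorm0 mulr0 rnorm_ge0.
  have n0 : 0 < rnorm x.
    by rewrite lt_def rnorm_ge0 andbT; apply: contraNneq x0 => /rnorm0_eq0 ->.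
  rewrite leNgt; apply/negP => hx; apply: (hc ((rnorm x)^-1%:C *: x)).
  rewrite BZ !rnormZ rnorm_real ger0_norm ?invr_ge0 ?rnorm_ge0// mulVf ?gt_eqF//.
  by split=> //; rewrite mulrC ler_pdivrMr// ltW.
have t0 n : 0 < (3^-1 : R) ^+ n by rewrite exprn_gt0// invr_gt0.
have s0 n : 0 < (2^-1 : R) ^+ n by rewrite exprn_gt0// invr_gt0.
have /choice[x hx] : forall n, exists x, rnorm x = 1 /\
    rnorm (B x) <= 3^-1 ^+ n * 2^-1 ^+ n.
  by move=> n; apply: small; rewrite mulr_gt0.
(* [f] picks the sign of the [n]-th hump, of size [3^-n], given the partial sum [y]. *)
have /choice[f hf] : forall ny : nat * H, exists z,
    rnorm (z - ny.2) <= 3^-1 ^+ ny.1 /\ 3^-1 ^+ ny.1 <= rnorm (dot z (x ny.1)).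
  by move=> [n y]; apply: dot_hump; [rewrite ltW|exact: (hx n).1].
pose y := fix y n := if n is k.+1 then f (k, y k) else 0 : H.
have [||l [_ hl]] := @cvgn_geometric R H y 1 3^-1.
- by rewrite invr_ge0 invf_lt1// ler0n ltr1n.
- by move=> n; rewrite mul1r; apply: (hf (n, y n)).1.
have [z Az] := surj l.
have key n : 1 <= 2 * rnorm z * 2^-1 ^+ n.
  have [x1 xB] := hx n; have [_ hump] := hf (n, y n).
  have h1 : rnorm (dot l (x n)) <= rnorm z * (3^-1 ^+ n * 2^-1 ^+ n).
    rewrite -Az adj (le_trans (cauchy_schwarz hdot _ _))//.
    by rewrite ler_wpM2l ?rnorm_ge0.
  have h2 : rnorm (dot (y n.+1) (x n)) <= rnorm (dot l (x n)) + rnorm (l - y n.+1).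
    have -> : dot (y n.+1) (x n) = dot l (x n) - dot (l - y n.+1) (x n).
      by rewrite [in RHS]linearBl /= subKr.
    rewrite (le_trans (ler_rnormD _ _))// lerD// rnormN.
    by rewrite (le_trans (cauchy_schwarz hdot _ _))// x1 mulr1.
  (* The tail constant is [1 / (1 - 1/3) * 1/3 = 1/2]: the later humps destroy at most half of the
     [n]-th one. *)
  have h3 := hl n.+1; rewrite exprS mulrA (_ : _ * 3^-1 = 2^-1) in h3; last by field.
  rewrite -(ler_pM2l (t0 n)); move: (t0 n) h1 h2 h3 hump => /=.
  set t := 3^-1 ^+ n; set s := 2^-1 ^+ n => tp h1 h2 h3 hump.
  lra.
have [n] := @geometric_small R (2 * rnorm z) 2^-1 1 ltac:(lra) ltr01.
by rewrite ltNge key.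
Qed.

(* As [B] is bounded below, [x |-> x + t (y - A (B x))] is a contraction for
   small [t], and its fixed point solves [A (B x) = y]. *)
Lemma bounded_right_inverse (K : R) : (forall x, rnorm (A x) <= K * rnorm x) ->
  (forall y, exists x, A x = y) ->
  exists L : R, forall y, exists x, A x = y /\ rnorm x <= L * rnorm y.
Proof.
move=> bA /adjoint_bounded_below[c c0 hc].
(* [B] inherits the bound of [A]: [|B x|^2 = <A (B x), x> <= |K| |B x| |x|]. *)
have bB x : rnorm (B x) <= `|K| * rnorm x.
  have [/rnorm0_eq0 ->|n0] := eqVneq (rnorm (B x)) 0.
    by rewrite rnorm0 mulr_ge0 ?rnorm_ge0.
  have n1 : 0 < rnorm (B x) by rewrite lt_def n0 rnorm_ge0.
  rewrite -(ler_pM2l n1) -expr2.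
  have : rnorm (B x) ^+ 2 = rnorm (dot (A (B x)) x).
    by rewrite adj (dotxx hdot) rnorm_real ger0_norm ?sqr_ge0.
  move=> ->; rewrite (le_trans (cauchy_schwarz hdot _ _))// mulrA.
  rewrite ler_wpM2r ?rnorm_ge0// (le_trans (bA _))// mulrC ler_wpM2l ?rnorm_ge0//.
  exact: ler_norm.
(* [|K|^2] already bounds [S]; adding [c^2] makes [L] positive and at least [c^2], whence
   [c^2 t <= 1]. *)
pose L := `|K| ^+ 2 + c ^+ 2; pose S x := A (B x).
have bS x : rnorm (S x) <= L * rnorm x.
  rewrite (le_trans (bA _))//; apply: (@le_trans _ _ (`|K| * (`|K| * rnorm x))).
    apply: (le_trans (ler_wpM2r (rnorm_ge0 _) (ler_norm K))).
    by rewrite ler_wpM2l.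
  by rewrite mulrA -expr2 ler_wpM2r ?rnorm_ge0// lerDl sqr_ge0.
have SB x y : S (x - y) = S x - S y by rewrite /S BB AB.
have SZ a x : S (a *: x) = a *: S x by rewrite /S BZ AZ.
have SE x : dot (S x) x = (rnorm (B x) ^+ 2)%:C by rewrite /S adj (dotxx hdot).
have c2 : 0 < c ^+ 2 by rewrite exprn_gt0.
have cL : c ^+ 2 <= L by rewrite lerDr sqr_ge0.
have L0 : 0 < L by exact: lt_le_trans cL.
(* [t] minimises [1 - 2 t c^2 + t^2 L^2], which bounds the squared contraction factor. The minimum
   is [1 - c^2 t], and [q^2] is at least that, so no square root is needed. *)
pose t := c ^+ 2 / L ^+ 2; pose q := 1 - c ^+ 2 * t / 2.
have t0 : 0 < t by rewrite divr_gt0 ?exprn_gt0.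
have ct0 : 0 < c ^+ 2 * t by rewrite mulr_gt0.
have ct1 : c ^+ 2 * t <= 1.
  by rewrite /t mulrA -expr2 -expr_div_n expr_le1// ?divr_ge0 ?(ltW L0) ?(ltW c2)//
    ler_pdivrMr// mul1r.
have tL : t ^+ 2 * L ^+ 2 = c ^+ 2 * t.
  by rewrite /t; field; rewrite gt_eqF.
have q01 : 0 <= q < 1 by rewrite /q; lra.
have q0 : 0 <= q by case/andP: q01.
have contr x : rnorm (x - t%:C *: S x) <= q * rnorm x.
  rewrite -(@ler_pXn2r _ 2) ?nnegrE ?mulr_ge0 ?rnorm_ge0// exprMn.
  have -> : rnorm (x - t%:C *: S x) ^+ 2 =
      rnorm x ^+ 2 + t ^+ 2 * rnorm (S x) ^+ 2 - 2 * t * rnorm (B x) ^+ 2.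
    have d : dot x (t%:C *: S x) = (t * rnorm (B x) ^+ 2)%:C.
      by rewrite dotZr (dotC dot x) SE !conjC_realc -rmorphM.
    apply: (@complexI R); rewrite -(dotxx hdot) dnormB dnormZ d conjC_realc.
    rewrite !(dotxx hdot) rnormE rnorm_real (ger0_norm (ltW t0)).
    by rewrite -rmorphXn -rmorphM -!rmorphD -rmorphB; congr _%:C; ring.
  have hB : (c * rnorm x) ^+ 2 <= rnorm (B x) ^+ 2.
    by rewrite lerXn2r ?nnegrE ?mulr_ge0 ?rnorm_ge0 ?(ltW c0).
  have hS : rnorm (S x) ^+ 2 <= (L * rnorm x) ^+ 2.
    by rewrite lerXn2r ?nnegrE ?mulr_ge0 ?rnorm_ge0 ?(ltW L0).
  have {}hS : t ^+ 2 * rnorm (S x) ^+ 2 <= c ^+ 2 * t * rnorm x ^+ 2.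
    by rewrite -tL -[leRHS]mulrA -(exprMn _ L) ler_wpM2l ?sqr_ge0.
  have {}hB : c ^+ 2 * t * rnorm x ^+ 2 <= t * rnorm (B x) ^+ 2.
    by rewrite [leLHS]mulrAC [leLHS]mulrC -(exprMn _ c) ler_wpM2l ?(ltW t0).
  have qq : 1 - c ^+ 2 * t <= q ^+ 2.
    have -> : q ^+ 2 = 1 - c ^+ 2 * t + (c ^+ 2 * t / 2) ^+ 2 by rewrite /q; field.
    by rewrite lerDl sqr_ge0.
  have := ler_wpM2r (sqr_ge0 (rnorm x)) qq; rewrite mulrBl mul1r; lra.
exists c^-1 => y.
(* The contraction is iterated from 0; the residual [r n] shrinks by the factor [q] at each step. *)
pose u := fix u n := if n is k.+1 then u k - t%:C *: (S (u k) - y) else 0 : H.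
pose r n := S (u n) - y.
have hr n : rnorm (r n) <= rnorm y * q ^+ n.
  elim: n => [|n IH].
    by rewrite /r /= -(subrr 0) SB subrr sub0r rnormN expr0 mulr1.
  have -> : r n.+1 = r n - t%:C *: S (r n).
    by rewrite {1}/r /= SB SZ -/(r n) addrAC.
  by rewrite (le_trans (contr _))// exprS mulrCA ler_wpM2l.
have [//|n|l [_ hl]] := @cvgn_geometric R H u (t * rnorm y) q.
  rewrite /= -/(r n) addrAC subrr add0r rnormN rnormZ rnorm_real ger0_norm ?(ltW t0)//.
  by rewrite -mulrA ler_wpM2l ?(ltW t0).
have Sl : S l = y.
  apply/eqP; rewrite -subr_eq0; apply/eqP/rnorm0_eq0/eqP.
  rewrite eq_le rnorm_ge0 andbT; apply/ler_addgt0Pr => e e0; rewrite add0r.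
  have [n /ltW hn] := @geometric_small R (L * (t * rnorm y / (1 - q)) + rnorm y) q e q01 e0.
  apply: le_trans hn; rewrite mulrDl -(mulrA L).
  apply: le_trans (ler_rdistD _ (S (u n)) _) (lerD _ (hr n)).
  by rewrite -SB (le_trans (bS _))// ler_wpM2l ?(ltW L0) ?hl.
(* [|B l|^2 = <y, l> <= |y| |l|] and [c |l| <= |B l|] give [|B l| <= c^-1 |y|]. *)
exists (B l); split=> //.
have [/rnorm0_eq0 ->|n0] := eqVneq (rnorm (B l)) 0.
  by rewrite rnorm0 mulr_ge0 ?rnorm_ge0// invr_ge0 ltW.
have n1 : 0 < rnorm (B l) by rewrite lt_def n0 rnorm_ge0.
rewrite ler_pdivlMl// -(ler_pM2l n1) mulrCA -expr2.
have -> : rnorm (B l) ^+ 2 = rnorm (dot y l).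
  by rewrite -Sl SE rnorm_real ger0_norm ?sqr_ge0.
apply: le_trans (ler_wpM2l (ltW c0) (cauchy_schwarz hdot _ _)) _.
by rewrite mulrCA [leRHS]mulrC ler_wpM2l ?rnorm_ge0.
Qed.

End BoundedInverse.

(** * Multipliers and separation by families of dual frames *)

Section Multipliers.
Variables (R : realType) (H : completeNormedModType R[i]).
Variable dot : {dot H for @conjC R[i]}.
Hypothesis hdot : hilbert_inner dot.
Implicit Types (h x y : H) (F G X : nat -> H) (m c : nat -> R[i]) (B K : R).

Lemma seminormalized_bounds m : seminormalized m ->
  (exists C : R, forall n, rnorm (m n) <= C) /\
  (forall n, m n != 0) /\ (exists C : R, forall n, rnorm (inv_seq m n) <= C).
Proof.
move=> [lo up]; split; [|split].
- move: up; case e: (ereal_sup _) => [C||] // _.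
    exists C => n; rewrite -lee_fin -e; apply: ereal_sup_ubound.
    by exists n.
  have : ((rnorm (m 0%N))%:E <= -oo)%E by rewrite -e; apply: ereal_sup_ubound; exists 0%N.
  by [].
- move=> n; apply: contraTneq lo => m0; rewrite -leNgt.
  by apply: ereal_inf_lbound; exists n; rewrite // m0 rnorm0.
- move: lo; case e: (ereal_inf _) => [C||] // lo.
    have lm n : C <= rnorm (m n).
      by rewrite -lee_fin -e; apply: ereal_inf_lbound; exists n.
    exists C^-1 => n; rewrite rnormV lef_pV2 ?posrE//.
    exact: lt_le_trans (lm n).
  have : (+oo <= (rnorm (m 0%N))%:E)%E by rewrite -e; apply: ereal_inf_lbound; exists 0%N.
  by [].
Qed.

Lemma multiplier_cvg m (C : R) F G B B' h : (forall n, rnorm (m n) <= C) ->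
  bessel dot F B -> bessel dot G B' ->
  series (fun n => (m n * dot h (G n)) *: F n) @ \oo --> multiplier dot m F G h.
Proof.
move=> hm hF hG; apply: (synthesis_cvg hdot hF).
exact: square_summableM hm (square_summable_dot h hG).
Qed.

(** Partial sums agree term by term. This supplies the adjoint pair for [bounded_right_inverse]. *)
Lemma multiplier_adjoint m (C : R) F G B B' : (forall n, rnorm (m n) <= C) ->
  bessel dot F B -> bessel dot G B' ->
  forall x y, dot (multiplier dot m F G x) y =
    dot x (multiplier dot (fun n => conjC (m n)) G F y).
Proof.
move=> hm hF hG x y.
have hm' n : rnorm (conjC (m n)) <= C by rewrite rnorm_conj.
apply: (dot_cvg_eq hdot (multiplier_cvg hm hF hG) (multiplier_cvg hm' hG hF)).
move=> N; rewrite /series /= linear_sumlz linear_sumr; apply: eq_bigr => n _ /=.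
by rewrite dotZl dotZr rmorphM /= conjCK -dotC mulrAC.
Qed.

Lemma cvg_series_sub0 (u v w : nat -> H) (l : H) : series u @ \oo --> l ->
  series v @ \oo --> l -> (forall n, w n = u n - v n) -> series w @ \oo --> (0 : H).
Proof.
move=> ul vl wE; rewrite -[X in _ --> X](subrr l).
apply: cvg_trans (cvgB ul vl); apply: near_eq_cvg; apply: nearW => N.
by rewrite /series !fctE /= -sumrB; apply: eq_bigr => n _; rewrite wE.
Qed.

(** For the perturbed dual frame, [series_perturb_cvg] at [s = 0] gives the limit [c j e], while the
    hypothesis gives 0. *)
Lemma dual_frames_synthesis_injective F c : (exists Fd, is_dual_frame dot F Fd) ->
  (forall Fd, is_dual_frame dot F Fd -> series (fun n => c n *: Fd n) @ \oo --> (0 : H)) ->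
  forall j (e : H), c j *: e = 0.
Proof.
move=> [Fd dFd] hc j e.
have l0 := series_perturb_cvg hdot F j e (hc Fd dFd).
have l1 := hc _ (dual_frame_perturb hdot j e dFd).
rewrite linear0l subr0 add0r in l0.
by rewrite -(cvg_unique_lim l0) (cvg_unique_lim l1).
Qed.

(** With [e = X j], the coefficients of [e] for the perturbed and the original dual frame differ by
    [<e, e> (delta_(n, j) - <F j, Fd n>)]. Adding [<e, e>] times the identity at [h = F j] cancels
    the last product and leaves [<e, e> m j X j = 0]. *)
Lemma dual_frames_analysis_injective F m X :
  (exists Fd, is_dual_frame dot F Fd) -> (forall n, m n != 0) ->
  (forall Fd h, is_dual_frame dot F Fd ->
    series (fun n => (m n * dot h (Fd n)) *: X n) @ \oo --> (0 : H)) ->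
  forall j, X j = 0.
Proof.
move=> [Fd dFd] m0 hX j; apply: contrapT => /eqP X0.
pose e := X j.
have l1 := hX _ e (dual_frame_perturb hdot j e dFd).
have l2 := hX _ e dFd; have l3 := hX _ (F j) dFd.
have l4 : (fun=> (dot e e * m j) *: X j : H) @ \oo --> (0 : H).
  rewrite -[X in _ --> X]addr0 -[X in _ --> X + _]subr0.
  rewrite -[X in _ --> _ + X](scaler0 _ (dot e e)).
  apply: cvg_trans (cvgD (cvgB l1 l2) (cvgZl_tmp l3)); apply: near_eq_cvg.
  exists j.+1 => // N /= jN.
  rewrite /series !fctE /= -sumrB scaler_sumr -big_split /=.
  rewrite [LHS](eq_bigr (fun n => (dot e e * m n * (n == j)%:R) *: X n)) => [|n _].
    rewrite big_mkord (bigD1 (Ordinal jN)) //= eqxx mulr1 big1 ?addr0// => n.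
    by rewrite -val_eqE /= => /negbTE ->; rewrite mulr0 scale0r.
  rewrite -scalerBl scalerA -scalerDl linearDr /= dotZr rmorphB /= -dotC.
  by rewrite conjC_nat; congr (_ *: _); ring.
have := cvg_unique_lim l4; rewrite (cvg_unique_lim (cvg_cst _)).
move/eqP; rewrite scaler_eq0 mulf_eq0 (negbTE (m0 j)) (negbTE X0) !orbF.
by rewrite dnorm_eq0 (negbTE X0).
Qed.

Lemma dual_frame_bessel F Fd : is_dual_frame dot F Fd -> exists B, bessel dot Fd B.
Proof. by case=> _ /frame_bessel. Qed.

End Multipliers.

(** * The inverse of the multiplier and the two dual frames *)

Section Main.
Variables (R : realType) (H : completeNormedModType R[i]).
Variable dot : {dot H for @conjC R[i]}.
Hypothesis hdot : hilbert_inner dot.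
Variables (Phi Psi : nat -> H) (m : nat -> R[i]).
Hypotheses (hPhi : is_frame dot Phi) (hPsi : is_frame dot Psi).
Hypothesis hm : seminormalized m.
Hypothesis hM : invertible_operator (multiplier dot m Phi Psi).

Local Notation M := (multiplier dot m Phi Psi).
Local Notation T := (inverse_operator M).

Lemma multiplier_inverseK y : M (T y) = y.
Proof.
have [_ [g gK Kg]] := hM; apply: (@pinvK _ _ _ setT); rewrite inE.
by exists (g y).
Qed.

Lemma inverse_multiplierK x : T (M x) = x.
Proof. by have [_ bM] := hM; apply: (bij_inj bM); rewrite multiplier_inverseK. Qed.

Lemma inverse_linear : linear T.
Proof.
move=> a x y; have [[lM _] bM] := hM; apply: (bij_inj bM).
by rewrite lM !multiplier_inverseK.
Qed.

Let T' : {linear H -> H} :=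
  HB.pack T (GRing.isLinear.Build _ _ _ _ _ inverse_linear).

(** Injectivity of [M] identifies the controlled solution of [M x = y] with [T y]. *)
Lemma inverse_bounded : exists L : R, forall y, rnorm (T y) <= L * rnorm y.
Proof.
have [[C hC] _] := seminormalized_bounds hm.
have [B hB] := frame_bessel hPhi; have [B' hB'] := frame_bessel hPsi.
have [[_ [K bM]] _] := hM.
have [|L hL] := bounded_right_inverse hdot (multiplier_adjoint hdot hC hB hB') bM.
  by move=> y; exists (T y); apply: multiplier_inverseK.
exists L => y; have [x [<- hx]] := hL y.
by rewrite inverse_multiplierK.
Qed.

Definition Psi_dag n := m n *: T (Phi n).

Lemma Psi_dag_dual : is_dual_frame dot Psi Psi_dag.
Proof.
have [[C hC] _] := seminormalized_bounds hm.
have [B hB] := frame_bessel hPhi; have [B' hB'] := frame_bessel hPsi.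
have [L hL] := inverse_bounded.
have TE c N : \sum_(0 <= n < N) c n *: Psi_dag n =
    T (\sum_(0 <= n < N) (m n * c n) *: Phi n).
  rewrite -[RHS]/(T' _) linear_sum; apply: eq_bigr => n _.
  by rewrite [RHS]linearZ_LR /= scalerA mulrC.
pose B1 := (`|L| + 1) ^+ 2 * (B * (`|C| + 1) ^+ 2).
have B10 : 0 < B1 by rewrite !mulr_gt0 ?hB.1 ?exprn_gt0// ltr_wpDl.
have hL' y : rnorm (T y) <= (`|L| + 1) * rnorm y.
  by rewrite (le_trans (hL y))// ler_wpM2r ?rnorm_ge0// (le_trans (ler_norm L))// lerDl.
have hC' n : rnorm (m n) <= `|C| + 1.
  by rewrite (le_trans (hC n))// (le_trans (ler_norm C))// lerDl.
have bes : bessel dot Psi_dag B1.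
  apply: bessel_of_synthesis => // c N; rewrite TE /B1 -mulrA.
  apply: (@le_trans _ _ (((`|L| + 1) * rnorm (\sum_(0 <= n < N) (m n * c n) *: Phi n)) ^+ 2)).
    by rewrite lerXn2r ?nnegrE ?mulr_ge0 ?addr_ge0 ?rnorm_ge0.
  rewrite exprMn ler_wpM2l ?sqr_ge0//.
  apply: le_trans (bessel_synthesis hdot _ _ _ hB) _.
  by rewrite -mulrA ler_wpM2l ?(ltW hB.1)//; exact: sqsumM.
(* [T] applied to the series of [M h] expands [h] in [Psi_dag] with coefficients [<h, Psi n>];
   symmetry of duality then exchanges the roles. *)
apply: (dual_frame_sym hdot); apply: (reconstruction_dual hdot bes hB') => h.
have := bounded_linear_cvg (linearB T') hL (multiplier_cvg hdot (h := h) hC hB hB').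
rewrite /= inverse_multiplierK; apply: cvg_trans.
apply: near_eq_cvg; apply: nearW => N /=.
by rewrite /series /= TE.
Qed.

Lemma inv_seqK n : inv_seq m n * m n = 1.
Proof. by have [_ [m0 _]] := seminormalized_bounds hm; rewrite mulVf. Qed.

(** Apply [T] termwise to [h = \sum <h, Phid n> Phi n]; the factor [m n] in [Psi_dag n] cancels
    [1 / m n]. *)
Lemma inverse_Psi_dag Phid : is_dual_frame dot Phi Phid ->
  T = multiplier dot (inv_seq m) Psi_dag Phid.
Proof.
move=> [_ _ rec]; apply/funext => h; symmetry; apply: cvg_unique_lim.
have [L hL] := inverse_bounded.
have := bounded_linear_cvg (linearB T') hL (rec h).
apply: cvg_trans; apply: near_eq_cvg; apply: nearW => N /=.
transitivity (T' (\sum_(0 <= n < N) dot h (Phid n) *: Phi n)); first by [].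
rewrite linear_sum; apply: eq_bigr => n _.
by rewrite [LHS]linearZ_LR /= scalerA mulrAC inv_seqK mul1r.
Qed.

(** The first conjunct records the property of the witness that [inverse_Phi_dag] uses; duality is
    then the series of [M (T h) = h]. *)
Lemma Phi_dag_exists : exists X, (forall n h, dot h (X n) = m n * dot (T h) (Psi n)) /\
  is_dual_frame dot Phi X.
Proof.
have [[C hC] _] := seminormalized_bounds hm.
have [B hB] := frame_bessel hPhi; have [B' hB'] := frame_bessel hPsi.
have [L hL] := inverse_bounded.
have /choice[X hX] : forall n, exists x, forall h, m n * dot (T h) (Psi n) = dot h x.
  pose K n := `|C| * (`|L| * rnorm (Psi n)).
  (* The representing vector is built from the dual pair [Psi], [Psi_dag]. *)
  move=> n; apply: (riesz_dual_frame hdot (K := K n) Psi_dag_dual) => [a x y|h].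
    by rewrite inverse_linear linearPl /= mulrDr mulrCA.
  rewrite rnormM /K -!mulrA; apply: ler_pM; rewrite ?rnorm_ge0//.
    exact: le_trans (hC n) (ler_norm C).
  apply: le_trans (cauchy_schwarz hdot _ _) _; rewrite mulrCA mulrC ler_wpM2l ?rnorm_ge0//.
  by rewrite (le_trans (hL h))// ler_wpM2r ?rnorm_ge0// ler_norm.
exists X; split=> //.
have hXb : bessel dot X ((`|C| ^+ 2) * (B' * `|L| ^+ 2) + 1).
  split=> [|h N]; first by rewrite ltr_wpDl// !mulr_ge0 ?sqr_ge0// ltW// hB'.1.
  have -> : (fun n => dot h (X n)) = (fun n => m n * dot (T h) (Psi n)).
    by apply/funext => n; rewrite hX.
  apply: le_trans (sqsumM _ _ _ (fun n => le_trans (hC n) (ler_norm C))) _.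
  rewrite mulrDl mul1r -(mulrA (`|C| ^+ 2)) ler_wpDr ?sqr_ge0// ler_wpM2l ?sqr_ge0//.
  apply: le_trans (hB'.2 _ _) _; rewrite -(mulrA B') ler_wpM2l ?(ltW hB'.1)// -exprMn.
  rewrite lerXn2r ?nnegrE ?mulr_ge0 ?rnorm_ge0// (le_trans (hL h))//.
  by rewrite ler_wpM2r ?rnorm_ge0// ler_norm.
apply: (reconstruction_dual hdot hB hXb) => h.
have := multiplier_cvg hdot (h := T h) hC hB hB'.
rewrite multiplier_inverseK; apply: cvg_trans; apply: near_eq_cvg.
by apply: nearW => N; apply: eq_bigr => n _; rewrite hX.
Qed.

(** Expand [T h = \sum <T h, Psi n> Psid n] and substitute [<T h, Psi n> = <h, X n> / m n]. *)
Lemma inverse_Phi_dag X Psid :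
  (forall n h, dot h (X n) = m n * dot (T h) (Psi n)) ->
  is_dual_frame dot Psi Psid -> T = multiplier dot (inv_seq m) Psid X.
Proof.
move=> hX /(dual_frame_sym hdot)[_ _ rec].
apply/funext => h; symmetry; apply: cvg_unique_lim.
have := rec (T h); apply: cvg_trans; apply: near_eq_cvg; apply: nearW => N /=.
by apply: eq_bigr => n _; rewrite hX mulrA inv_seqK mul1r.
Qed.

End Main.


Theorem theorem1p1 (R : realType) (H : completeNormedModType R[i])
    (dot : {dot H for @conjC R[i]}) (hdot : hilbert_inner dot)
    (hsep : separable H)
    (Phi Psi : nat -> H) (hPhi : is_frame dot Phi) (hPsi : is_frame dot Psi)
    (m : nat -> R[i]) (hm : seminormalized m)
    (hM : invertible_operator (multiplier dot m Phi Psi)) :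
  (exists! Phidag : nat -> H, is_dual_frame dot Phi Phidag /\
     forall Psid : nat -> H, is_dual_frame dot Psi Psid ->
       inverse_operator (multiplier dot m Phi Psi)
       = multiplier dot (inv_seq m) Psid Phidag) /\
  (exists! Psidag : nat -> H, is_dual_frame dot Psi Psidag /\
     forall Phid : nat -> H, is_dual_frame dot Phi Phid ->
       inverse_operator (multiplier dot m Phi Psi)
       = multiplier dot (inv_seq m) Psidag Phid).
Proof.
have [_ [m0 [C hC]]] := seminormalized_bounds hm.
have im0 n : inv_seq m n != 0 by rewrite invr_eq0.
split.
- have [X [hX dX]] := Phi_dag_exists hdot hPhi hPsi hm hM.
  exists X; split=> [|Y [dY hY]].
    by split=> // Psid; apply: inverse_Phi_dag.
  have [BX bX] := dual_frame_bessel dX; have [BY bY] := dual_frame_bessel dY.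
  apply/funext => j; apply/eqP; rewrite -subr_eq0; apply/eqP; set d := X j - Y j.
  (* Both candidates represent [T d], so [\sum c n Psid n = 0] for every [Psid]. The choice of [d]
     makes [c j = |d|^2 / m j], hence [c j d = 0] forces [d = 0]. *)
  pose c n := inv_seq m n * dot d (X n) - inv_seq m n * dot d (Y n).
  have cj : c j *: d = 0.
    apply: (dual_frames_synthesis_injective hdot (F := Psi)) => [|Psid dPsid].
      by exists (Psi_dag dot Phi Psi m); apply: Psi_dag_dual.
    have [B bB] := dual_frame_bessel dPsid.
    have lX := multiplier_cvg hdot (h := d) hC bB bX.
    have lY := multiplier_cvg hdot (h := d) hC bB bY.
    rewrite -(inverse_Phi_dag hdot hm hX dPsid) in lX.
    rewrite -(hY _ dPsid) in lY.
    by apply: cvg_series_sub0 lX lY _ => n; rewrite scalerBl.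
  move/eqP: cj; rewrite scaler_eq0 /c -mulrBr -linearBr /= mulf_eq0 (negbTE (im0 j)) /=.
  by rewrite dnorm_eq0 orbb => /eqP.
- exists (Psi_dag dot Phi Psi m).
  have dP := Psi_dag_dual hdot hPhi hPsi hm hM.
  have hP Phid : is_dual_frame dot Phi Phid -> _ :=
    inverse_Psi_dag hdot hPhi hPsi hm hM (Phid := Phid).
  split=> [|Y [dY hY]]; first by split.
  have [BX bX] := dual_frame_bessel dP; have [BY bY] := dual_frame_bessel dY.
  apply/funext => j; apply/eqP; rewrite -subr_eq0; apply/eqP.
  (* Both candidates represent [T h] with every dual frame of [Phi], so their difference synthesises
     0. *)
  apply: (dual_frames_analysis_injective hdot (F := Phi) (m := inv_seq m)
    (X := fun n => Psi_dag dot Phi Psi m n - Y n)) => // [|Phid h dPhid].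
    (* The first construction supplies a dual frame of [Phi]. *)
    by have [X [_ dX]] := Phi_dag_exists hdot hPhi hPsi hm hM; exists X.
  have [B bB] := dual_frame_bessel dPhid.
  have lX := multiplier_cvg hdot (h := h) hC bX bB.
  have lY := multiplier_cvg hdot (h := h) hC bY bB.
  rewrite -(hP _ dPhid) in lX; rewrite -(hY _ dPhid) in lY.
  by apply: cvg_series_sub0 lX lY _ => n; rewrite scalerBr.
Qed.
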